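(* Let $m<n$ be positive integers, let $M\in\mathbb R^{n\times n}$ be symmetric positive definite, $A\in\mathbb R^{n\times n}$ arbitrary, and $B\in\mathbb R^{m\times n}$ of full rank $m$. For $\tau>0$ (small enough that $\tfrac1\tau M+A$ is invertible) consider the SIMPLE scheme $$\tfrac1\tau M\tilde v^{k+1}=(\tfrac1\tau M+A)v^k+B^{T}p^k+f^k,$$ $$B(\tfrac1\tau M+A)^{-1}B^{T}p_\Delta^{k+1}=-B\tilde v^{k+1}+g^{k+1},$$ $$v^{k+1}=\tilde v^{k+1}+(\tfrac1\tau M+A)^{-1}B^{T}p_\Delta^{k+1},\qquad p^{k+1}=p^k+p_\Delta^{k+1},$$ written (after shifting the time index in the second equation) as a difference-algebraic equation $\mathcal E x^{k+1}=\mathcal A x^k+h^k$ with $x^k=[\tilde v^k;p_\Delta^k;v^k;p^k]$ and $$(\mathcal E,\mathcal A)=\left(\begin{bmatrix} \tfrac1\tau M & 0 & 0 & 0 \\ 0 & 0 & 0 & 0 \\ I & (\tfrac1\tau M+A)^{-1}B^{T} & -I & 0 \\ 0 & -I & 0 & I\end{bmatrix},\ \begin{bmatrix} 0 & 0 & \tfrac1\tau M+A & B^{T} \\ -B & -B(\tfrac1\tau M+A)^{-1}B^{T} & 0 & 0 \\ 0 & 0 & 0 & 0 \\ 0 & 0 & 0 & I\end{bmatrix}\right).$$ Then for all sufficiently small $\tau>0$ the matrix pair $(\mathcal E,\mathcal A)$ is regular and of index $1$; that is, the SIMPLE scheme is a difference-algebraic equation of Kronecker index $1$.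
   Context: A pair $(\mathcal E,\mathcal A)$ of square matrices of the same size is regular if $\det(\lambda\mathcal E-\mathcal A)$ is not the zero polynomial in $\lambda$. Two pairs $(\mathcal E,\mathcal A)$ and $(\tilde{\mathcal E},\tilde{\mathcal A})$ are equivalent if $\tilde{\mathcal E}=P\mathcal E Q$ and $\tilde{\mathcal A}=P\mathcal A Q$ for some nonsingular matrices $P,Q$. A regular pair is equivalent to a pair $$\left(\begin{bmatrix} I & 0 \\ 0 & N\end{bmatrix},\begin{bmatrix} J & 0 \\ 0 & I\end{bmatrix}\right)$$ with $N$ nilpotent. The index of the pair, equivalently the Kronecker index of the difference-algebraic equation $\mathcal E x^{k+1}=\mathcal A x^k+h^k$, is the integer $\nu$ with $N^\nu=0$ and $N^{\nu-1}\neq0$ (in particular, the index is $1$ if $N=0$ is present with positive size). *)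

(* Defs.v *)
From HB Require Import structures.
From mathcomp Require Import all_boot all_order all_algebra.
From mathcomp Require Import reals.

Set Implicit Arguments.
Unset Strict Implicit.
Unset Printing Implicit Defensive.

Import Order.TTheory GRing.Theory Num.Theory.

Local Open Scope ring_scope.

Definition sym_posdef (R : realType) (n : nat) (M : 'M[R]_n) : Prop :=
  M^T = M /\ forall x : 'cV[R]_n, x != 0 -> 0 < (x^T *m M *m x) 0 0.

Definition regular_pair (R : realType) (n : nat) (E A : 'M[R]_n) : Prop :=
  \det ('X *: map_mx polyC E - map_mx polyC A) != 0.

Definition equiv_pairs (R : realType) (n : nat)
    (E A E' A' : 'M[R]_n) : Prop :=
  exists P Q : 'M[R]_n,
    [/\ P \in unitmx, Q \in unitmx, E' = P *m E *m Q & A' = P *m A *m Q].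

(* Either block of the canonical form (diag(I, N), diag(J, I)) may be empty.
   Note that [nu = 0] is excluded: since [0.-1 = 0], the two conditions on [N]
   contradict each other. If [N] has size 0, all its powers vanish (also
   N ^+ 0), so a nonempty block [N] is required, and index 1 means that [N] is
   the zero matrix of positive size. *)
Definition has_index (R : realType) (n : nat) (E A : 'M[R]_n) (nu : nat) :
    Prop :=
  exists (r s : nat) (rs : (r + s)%N = n) (J : 'M[R]_r) (N : 'M[R]_s),
    [/\ equiv_pairs E A (castmx (rs, rs) (block_mx 1%:M 0 0 N))
                        (castmx (rs, rs) (block_mx J 0 0 1%:M)),
        N ^+ nu = 0 & N ^+ nu.-1 != 0].

Definition is_dae_solution (R : realType) (n : nat) (E A : 'M[R]_n)
    (h x : nat -> 'cV[R]_n) : Prop :=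
  forall k, E *m x k.+1 = A *m x k + h k.

Section Simple.

Variables (R : realType) (m n : nat).
Variables (tau : R) (M A : 'M[R]_n) (B : 'M[R]_(m, n)).

Definition simple_K : 'M[R]_n := tau^-1 *: M + A.

(* The second equation of the scheme is this one at index k + 1. *)
Definition simple_pressure_eq (g : nat -> 'cV[R]_m) (vt : nat -> 'cV[R]_n)
    (pD : nat -> 'cV[R]_m) (k : nat) : Prop :=
  B *m invmx simple_K *m B^T *m pD k = - (B *m vt k) + g k.

(* [vt] is the intermediate velocity and [pD] the pressure increment. *)
Definition simple_scheme (f : nat -> 'cV[R]_n) (g : nat -> 'cV[R]_m)
    (vt : nat -> 'cV[R]_n) (pD : nat -> 'cV[R]_m)
    (v : nat -> 'cV[R]_n) (p : nat -> 'cV[R]_m) : Prop :=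
  forall k,
    [/\ tau^-1 *: M *m vt k.+1 = simple_K *m v k + B^T *m p k + f k,
        simple_pressure_eq g vt pD k.+1,
        v k.+1 = vt k.+1 + invmx simple_K *m B^T *m pD k.+1
      & p k.+1 = p k + pD k.+1].

(* The 4 x 4 block matrices are written as 2 x 2 arrays of 2 x 2 blocks. *)
Definition simple_E : 'M[R]_((n + m) + (n + m)) :=
  block_mx
    (block_mx (tau^-1 *: M) 0
              0             0)
    (block_mx 0 0
              0 0)
    (block_mx 1%:M (invmx simple_K *m B^T)
              0    (- 1%:M))
    (block_mx (- 1%:M) 0
              0        1%:M).

Definition simple_A : 'M[R]_((n + m) + (n + m)) :=
  block_mx
    (block_mx 0     0
              (- B) (- (B *m invmx simple_K *m B^T)))
    (block_mx simple_K B^T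
              0        0)
    (block_mx 0 0
              0 0)
    (block_mx 0 0
              0 1%:M).

End Simple.

Definition stack4 (R : realType) (m n : nat) (a : 'cV[R]_n) (b : 'cV[R]_m)
    (c : 'cV[R]_n) (d : 'cV[R]_m) : 'cV[R]_((n + m) + (n + m)) :=
  col_mx (col_mx a b) (col_mx c d).

(* Main.v *)
Require Import Defs.
From HB Require Import structures.
From mathcomp Require Import all_boot all_order all_algebra.
From mathcomp Require Import reals.

Set Implicit Arguments.
Unset Strict Implicit.
Unset Printing Implicit Defensive.

Import Order.TTheory GRing.Theory Num.Theory.

Local Open Scope ring_scope.

(** The index is read off without computing a canonical form of the pair. A
    pair (E, F) with E singular has index one as soon as F is injective on
    ker E modulo im E ([index1_of_inj_mod_im]): in bases where E is
    diag(I, 0), this says that the lower right block of F is invertible, and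
    block elimination with that pivot gives diag(I, 0), diag(J, I). Regularity
    then follows from the canonical form ([has_index_regular]).

    For the scheme, write K for tau^-1 M + A and S for the Schur complement
    B K^-1 B^T. A vector of ker E has vt = 0, v = K^-1 B^T pD and p = pD, so pD
    determines it. F sends this vector to one whose second block is - S pD,
    while all vectors of im E have a zero second block. Hence the pair has
    index one when S is invertible ([simple_index1]); E is singular because
    m > 0.

    The matrices K and S are invertible for small tau ([schur_unit_near0])
    because, up to nonzero scalars, their determinants are the polynomials
    det (M + tau A) and det (B adj(M + tau A) B^T) in tau. At tau = 0 neither
    vanishes, since M is positive definite and B^T is injective
    ([posdef_schur_unit]), and a polynomial that is nonzero at 0 stays nonzero
    nearby. *)

(** * Invertibility of matrices *)

Lemma unitmx_inj (F : fieldType) n (W : 'M[F]_n) :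
  (forall x : 'cV[F]_n, W *m x = 0 -> x = 0) -> W \in unitmx.
Proof.
move=> injW; rewrite -unitmx_tr -row_free_unit -kermx_eq0.
apply/eqP/row_matrixP => i; rewrite row0; apply: trmx_inj; rewrite trmx0.
by apply: injW; apply: trmx_inj; rewrite trmx_mul trmxK -row_mul mulmx_ker
  row0 trmx0.
Qed.

Lemma posdef_unit (R : realType) n (M : 'M[R]_n) :
  sym_posdef M -> M \in unitmx.
Proof.
move=> [_ posM]; apply: unitmx_inj => x Mx0; apply/eqP/negPn/negP => /posM.
by rewrite -mulmxA Mx0 mulmx0 mxE ltxx.
Qed.

(** If B M^-1 B^T x = 0, then z = M^-1 B^T x has z^T M z = x^T B M^-1 B^T x = 0,
    so z = 0 and B^T x = 0, where B^T is injective. *)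
Lemma posdef_schur_unit (R : realType) m n (M : 'M[R]_n) (B : 'M[R]_(m, n)) :
  sym_posdef M -> \rank B = m -> B *m invmx M *m B^T \in unitmx.
Proof.
move=> hM hB; have uM := posdef_unit hM; have [symM posM] := hM.
apply: unitmx_inj => x Sx0; set z := invmx M *m (B^T *m x).
have Mz : M *m z = B^T *m x by rewrite mulKVmx.
have z0 : z = 0.
  apply/eqP/negPn/negP => /posM; rewrite -[in X in _ < X]mulmxA.
  have -> : z^T *m (M *m z) = x^T *m (B *m invmx M *m B^T *m x).
    by rewrite Mz !trmx_mul trmx_inv symM trmxK !mulmxA.
  by rewrite Sx0 mulmx0 mxE ltxx.
have freeB : row_free B by rewrite /row_free hB.
apply: trmx_inj; rewrite trmx0; apply: (row_free_inj freeB).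
by apply: trmx_inj; rewrite mul0mx trmx0 trmx_mul trmxK -Mz z0 mulmx0.
Qed.

(** * Persistence for small time steps *)

(** Write p = q X + p(0). A bound of |q| by 1 + |c| on [0, 1] keeps the first
    term smaller than |p(0)| near 0. *)
Lemma poly_neq0_near0 (R : realFieldType) (p : {poly R}) :
  p.[0] != 0 ->
  exists2 t0 : R, 0 < t0 & forall t, 0 < t -> t < t0 -> p.[t] != 0.
Proof.
move=> p0.
have [q Dp] : exists q, p = q * 'X + p.[0]%:P.
  have : root (p - p.[0]%:P) 0 by rewrite rootE !hornerE subrr.
  by case/factor_theorem => q; rewrite subr0 => Dq; exists q; rewrite -Dq subrK.
have [c hc] := poly_itv_bound q 0 1.
have c1 : 0 < 1 + `|c| by rewrite ltr_wpDr.
exists (Num.min 1 (`|p.[0]| / (1 + `|c|))).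
  by rewrite lt_min ltr01 divr_gt0 ?normr_gt0.
move=> t t_gt0; rewrite lt_min => /andP[t1 tc].
have qt : `|q.[t]| < 1 + `|c|.
  apply: le_lt_trans (hc t _) _; first by rewrite !ltW.
  by apply: le_lt_trans (ler_norm c) _; rewrite ltrDr.
apply/negP => /eqP; rewrite Dp !hornerE => /eqP.
rewrite addr_eq0 => /eqP /(congr1 Num.norm); rewrite normrN normrM => E.
have: `|p.[0]| < `|p.[0]|.
  rewrite -{1}E (gtr0_norm t_gt0); move: tc; rewrite ltr_pdivlMr // => tc.
  apply: le_lt_trans tc; rewrite mulrC ler_pM2l //; exact: ltW.
by rewrite ltxx.
Qed.

(** The adjugate replaces the inverse because its entries depend polynomially on
    those of W. *)
Lemma schur_adj_unit (F : fieldType) m n (W : 'M[F]_n) (B : 'M[F]_(m, n)) :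
  W \in unitmx ->
  (B *m invmx W *m B^T \in unitmx) = (B *m \adj W *m B^T \in unitmx).
Proof.
move=> uW; rewrite /invmx uW -scalemxAr -scalemxAl unitmxZ //.
by rewrite unitrV -unitmxE.
Qed.

Lemma schurZ_unit (F : fieldType) m n a (W : 'M[F]_n) (B : 'M[F]_(m, n)) :
  a != 0 -> W \in unitmx ->
  (B *m invmx (a *: W) *m B^T \in unitmx) = (B *m invmx W *m B^T \in unitmx).
Proof.
move=> a0 uW; have ua : a \is a GRing.unit by rewrite unitfE.
by rewrite invmxZ ?unitmxZ // -scalemxAr -scalemxAl unitmxZ // unitrV.
Qed.

(** Invertibility of both matrices is the nonvanishing of one polynomial p in
    tau, obtained over R[X] from M + X A and its adjugate. *)
Lemma schur_unit_near0 (R : realType) m n (M A : 'M[R]_n) (B : 'M[R]_(m, n)) :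
  M \in unitmx -> B *m invmx M *m B^T \in unitmx ->
  exists2 tau0 : R, 0 < tau0 & forall tau, 0 < tau -> tau < tau0 ->
    simple_K tau M A \in unitmx /\
    B *m invmx (simple_K tau M A) *m B^T \in unitmx.
Proof.
move=> uM uS.
pose Mp : 'M[{poly R}]_n := map_mx polyC M + 'X *: map_mx polyC A.
pose p := \det Mp * \det (map_mx polyC B *m \adj Mp *m map_mx polyC B^T).
have evC k l (W : 'M[R]_(k, l)) t : map_mx (horner_eval t) (map_mx polyC W) = W.
  by apply/matrixP=> i j; rewrite !mxE /horner_eval hornerC.
have evM t : map_mx (horner_eval t) Mp = M + t *: A.
  by rewrite map_mxD map_mxZ !evC /= /horner_eval hornerX.
have evp t : p.[t] = \det (M + t *: A) * \det (B *m \adj (M + t *: A) *m B^T).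
  rewrite -[LHS]/(horner_eval t p) rmorphM /= -!det_map_mx !map_mxM !map_mx_adj.
  by rewrite !evC evM.
have evu t : (p.[t] != 0) = (M + t *: A \in unitmx)
                          && (B *m \adj (M + t *: A) *m B^T \in unitmx).
  by rewrite evp mulf_eq0 negb_or !unitmxE !unitfE.
have [|tau0 tau0_gt0 hp] := @poly_neq0_near0 R p.
  by rewrite evu scale0r addr0 uM -schur_adj_unit.
exists tau0 => // tau tau_gt0 /hp => /(_ tau_gt0); rewrite evu => /andP[uW].
rewrite -schur_adj_unit // => uSt.
have tau0' : tau^-1 != 0 by rewrite invr_eq0 gt_eqF.
have -> : simple_K tau M A = tau^-1 *: (M + tau *: A).
  by rewrite scalerDr scalerA mulVf ?scale1r ?gt_eqF.
by rewrite schurZ_unit // unitmxZ // unitfE.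
Qed.

(** * Matrix pairs of index one *)

(** Up to nonzero constants, det (X E - A) is the characteristic polynomial of J,
    which is monic, times det (X N - I), whose value at 0 is 1 or -1. *)
Lemma has_index_regular (R : realType) n (E A : 'M[R]_n) nu :
  has_index E A nu -> regular_pair E A.
Proof.
case=> r [s] [rs] [J] [N] [].
move: rs E A; case: n / => E A; rewrite !castmx_id.
case=> P [Q] [uP uQ DE DA] _ _; rewrite /regular_pair.
set W := 'X *: _ - _.
have: \det (map_mx polyC P *m W *m map_mx polyC Q) != 0.
  rewrite /W mulmxBr mulmxBl -scalemxAr -scalemxAl -!map_mxM -DE -DA.
  rewrite !map_block_mx scale_block_mx opp_block_mx add_block_mx !map_mx0.
  rewrite !scaler0 !oppr0 !addr0 det_ublock mulf_neq0 //.
    by rewrite map_mx1 scalemx1 monic_neq0 ?char_poly_monic.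
  apply: contraTneq (unitr1 R) => /(congr1 (horner_eval 0)).
  rewrite rmorph0 -det_map_mx.
  have -> : map_mx (horner_eval 0) ('X *: map_mx polyC N - map_mx polyC 1%:M)
            = - 1%:M.
    by apply/matrixP=> i j; rewrite !mxE /horner_eval !hornerE.
  by rewrite -scaleN1r detZ det1 mulr1 => /eqP; rewrite signr_eq0.
by apply: contra_neq => W0; rewrite !det_mulmx W0 mulr0 mul0r.
Qed.

(** The case of a pair in which a normal form L diag(I, 0) U of E is known. In
    the corresponding bases let A' have blocks G, H, C, D. The hypothesis says
    that D is injective. Row operations with pivot D then clear H, and column
    operations clear C; they preserve diag(I, 0) and leave the Schur complement
    J = G - H D^-1 C. *)
Lemma index1_of_normal_form (R : realType) r s n (rs : (r + s)%N = n)
    (E A L U : 'M[R]_n) :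
  L \in unitmx -> U \in unitmx ->
  E = L *m castmx (rs, rs) (block_mx 1%:M 0 0 0) *m U ->
  (forall x y : 'cV_n, E *m x = 0 -> A *m x = E *m y -> x = 0) ->
  (0 < s)%N -> has_index E A 1.
Proof.
move=> uL uU DE injA s_gt0; exists r, s, rs.
move: E A L U uL uU DE injA; case: n / rs => E A L U uL uU DE injA.
rewrite !castmx_id in DE *.
have [A' DA] : exists A', A = L *m A' *m U.
  exists (invmx L *m A *m invmx U).
  by rewrite !mulmxA mulmxV // mul1mx mulmxKV.
pose D := drsubmx A'.
have uD : D \in unitmx.
  apply: unitmx_inj => z Dz0; pose x : 'cV_(r + s) := col_mx 0 z.
  (* In the original coordinates x is a vector of ker E that A sends into im E. *)
  suff: invmx U *m x = 0.
    move/(congr1 (mulmx U)); rewrite mulKVmx // mulmx0 => /(congr1 dsubmx).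
    by rewrite col_mxKd linear0.
  apply: (injA _ (invmx U *m col_mx (ursubmx A' *m z) 0)).
    by rewrite DE -!mulmxA mulKVmx // mul_block_col !mulmx0 !mul0mx !addr0
      col_mx0 mulmx0.
  rewrite DE DA -!mulmxA !mulKVmx // -[in LHS](submxK A') !mul_block_col.
  by rewrite !mulmx0 !mul0mx mul1mx !add0r !addr0 -/D Dz0.
pose G := ulsubmx A'; pose H := ursubmx A'; pose C := dlsubmx A'.
exists (G - H *m invmx D *m C), 0; split; last 2 first.
- by rewrite expr1.
- by case: (s) s_gt0 => // s' _; rewrite expr0 oner_eq0.
exists (block_mx 1%:M (- (H *m invmx D)) 0 (invmx D) *m invmx L).
exists (invmx U *m block_mx 1%:M 0 (- (invmx D *m C)) 1%:M).
split.
- by rewrite unitmx_mul unitmx_inv uL unitmxE det_ublock det1 mul1r -unitmxE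
    unitmx_inv uD.
- by rewrite unitmx_mul unitmx_inv uU unitmxE det_lblock !det1 mulr1 unitr1.
- rewrite DE !mulmxA mulmxKV // mulmxK //.
  by rewrite !mulmx_block !(mulmx0, mul0mx, mul1mx, mulmx1, addr0).
- rewrite DA !mulmxA mulmxKV // mulmxK // -(submxK A') -/G -/H -/C -/D.
  rewrite !mulmx_block !(mul0mx, mulmx0, mul1mx, mulmx1, add0r, addr0).
  by rewrite !mulNmx mulmxKV // subrr mul0mx addr0 mulVmx // mul1mx addrN.
Qed.

(** The normal form of E comes from Gaussian elimination; the size
    n - rank E of the nilpotent block is positive since E is singular. *)
Lemma index1_of_inj_mod_im (R : realType) n (E A : 'M[R]_n) :
  E \notin unitmx ->
  (forall x y : 'cV_n, E *m x = 0 -> A *m x = E *m y -> x = 0) ->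
  has_index E A 1.
Proof.
move=> nuE injA; have rE : (\rank E < n)%N.
  by rewrite ltn_neqAle rank_leq_row andbT -[_ == n]/(row_free E) row_free_unit.
have rs := subnKC (ltnW rE).
apply: (@index1_of_normal_form _ _ _ _ rs _ _ _ _ (col_ebase_unit E) (row_ebase_unit E))
  => //; last by rewrite subn_gt0.
rewrite -{1}(mulmx_ebase E); congr (_ *m _ *m _).
move: (\rank E) (n - \rank E)%N rs => {rE injA nuE E A} r s; case: n /.
by rewrite castmx_id -pid_mx_block.
Qed.

(** * The pair of the scheme *)

Lemma stack4_inj (R : realType) m n (a a' : 'cV[R]_n) (b b' : 'cV[R]_m)
    (c c' : 'cV[R]_n) (d d' : 'cV[R]_m) :
  stack4 a b c d = stack4 a' b' c' d' -> [/\ a = a', b = b', c = c' & d = d'].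
Proof. by case/eq_col_mx => /eq_col_mx[-> ->] /eq_col_mx[-> ->]. Qed.

Lemma stack4D (R : realType) m n (a a' : 'cV[R]_n) (b b' : 'cV[R]_m)
    (c c' : 'cV[R]_n) (d d' : 'cV[R]_m) :
  stack4 a b c d + stack4 a' b' c' d' =
  stack4 (a + a') (b + b') (c + c') (d + d').
Proof. by rewrite /stack4 !add_col_mx. Qed.

Lemma stack4K (R : realType) m n (x : 'cV[R]_((n + m) + (n + m))) :
  x = stack4 (usubmx (usubmx x)) (dsubmx (usubmx x))
             (usubmx (dsubmx x)) (dsubmx (dsubmx x)).
Proof. by rewrite /stack4 !vsubmxK. Qed.

Section SimplePair.

Variables (R : realType) (m n : nat) (tau : R) (M A : 'M[R]_n).
Variable B : 'M[R]_(m, n).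

Local Notation K := (simple_K tau M A).
Local Notation E := (simple_E tau M A B).
Local Notation AA := (simple_A tau M A B).

Lemma mul_simple_E a b c d :
  E *m stack4 a b c d =
  stack4 (tau^-1 *: M *m a) 0 (a + invmx K *m B^T *m b - c) (d - b).
Proof.
rewrite /simple_E /stack4 !mul_block_col !add_col_mx !mul0mx !mulNmx !mul1mx.
by rewrite !addr0 !add0r [- b + d]addrC.
Qed.

Lemma mul_simple_A a b c d :
  AA *m stack4 a b c d =
  stack4 (K *m c + B^T *m d) (- (B *m a) - B *m invmx K *m B^T *m b) 0 d.
Proof.
rewrite /simple_A /stack4 !mul_block_col !add_col_mx !mul0mx !mulNmx !mul1mx.
by rewrite !addr0 !add0r.
Qed.

(** The rows of the pair couple step k.+1 of three equations of the scheme with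
    step k of the pressure equation. Shifting the latter leaves its instance at
    0 as a separate condition. *)
Lemma simple_dae f g vt pD v p :
  is_dae_solution E AA (fun k => stack4 (f k) (g k) 0 0)
    (fun k => stack4 (vt k) (pD k) (v k) (p k))
  <-> simple_pressure_eq tau M A B g vt pD 0 /\
      simple_scheme tau M A B f g vt pD v p.
Proof.
have stepE k : E *m stack4 (vt k.+1) (pD k.+1) (v k.+1) (p k.+1) =
    AA *m stack4 (vt k) (pD k) (v k) (p k) + stack4 (f k) (g k) 0 0 <->
    [/\ tau^-1 *: M *m vt k.+1 = K *m v k + B^T *m p k + f k,
        simple_pressure_eq tau M A B g vt pD k,
        v k.+1 = vt k.+1 + invmx K *m B^T *m pD k.+1
      & p k.+1 = p k + pD k.+1].
  rewrite mul_simple_E mul_simple_A stack4D !addr0.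
  rewrite /simple_pressure_eq; split.
    case/stack4_inj => -> e2 e3 e4; split=> //.
    - by apply/eqP; rewrite eq_sym -subr_eq0 addrAC -e2.
    - by apply/eqP; rewrite eq_sym -subr_eq0 e3.
    - by rewrite -e4 subrK.
  case=> -> -> -> ->.
  by rewrite subrr addrK opprD opprK addrA addNr sub0r addNr.
split=> [sol | [p0 sch] k].
  split; first by have /stepE[] := sol 0%N.
  by move=> k; have /stepE[e1 _ e3 e4] := sol k; have /stepE[_ e2 _ _] := sol k.+1.
apply/stepE; have [e1 _ e3 e4] := sch k; split=> //.
by case: k {e1 e3 e4} => // k; have [] := sch k.
Qed.

Lemma simple_index1 :
  (0 < m)%N -> tau != 0 -> M \in unitmx -> B *m invmx K *m B^T \in unitmx ->
  has_index E AA 1.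
Proof.
move=> m_gt0 tau0 uM uS; apply: index1_of_inj_mod_im.
  (* The second block of every vector of im E vanishes. *)
  apply/negP => uE.
  pose y : 'cV[R]_((n + m) + (n + m)) := stack4 0 (const_mx 1) 0 0.
  have := mulKVmx uE y; rewrite [invmx E *m y]stack4K mul_simple_E.
  case/stack4_inj => _ /matrixP/(_ (Ordinal m_gt0) 0) + _ _.
  by rewrite !mxE => /eqP; rewrite eq_sym oner_eq0.
have st0 : (0 : 'cV[R]_((n + m) + (n + m))) = stack4 0 0 0 0.
  by rewrite /stack4 !col_mx0.
move=> x y; rewrite (stack4K x) (stack4K y) mul_simple_A !mul_simple_E st0.
move: (usubmx (usubmx x)) (dsubmx (usubmx x)) => a b.
move: (usubmx (dsubmx x)) (dsubmx (dsubmx x)) => c d.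
case/stack4_inj => Ma0 _ /eqP + /eqP; rewrite !subr_eq0 => /eqP cE /eqP dE.
have a0 : a = 0.
  have uT : tau^-1 *: M \in unitmx by rewrite unitmxZ // unitrV unitfE.
  by rewrite -(mulKmx uT a) Ma0 mulmx0.
case/stack4_inj => _ + _ _; rewrite a0 mulmx0 oppr0 sub0r => /eqP.
rewrite oppr_eq0 => /eqP Sb0.
have b0 : b = 0 by rewrite -(mulKmx uS b) Sb0 mulmx0.
by rewrite dE -cE a0 b0 mulmx0 addr0.
Qed.

End SimplePair.

Theorem mainTheorem4 (R : realType) (m n : nat) (hm : (0 < m)%N)
    (hmn : (m < n)%N) (M A : 'M[R]_n) (B : 'M[R]_(m, n))
    (hM : sym_posdef M) (hB : \rank B = m) :
  exists2 tau0 : R, 0 < tau0 &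
    forall tau : R, 0 < tau -> tau < tau0 ->
      [/\ simple_K tau M A \in unitmx,
          (forall (f : nat -> 'cV[R]_n) (g : nat -> 'cV[R]_m)
                  (vt : nat -> 'cV[R]_n) (pD : nat -> 'cV[R]_m)
                  (v : nat -> 'cV[R]_n) (p : nat -> 'cV[R]_m),
              is_dae_solution (simple_E tau M A B) (simple_A tau M A B)
                (fun k => stack4 (f k) (g k) 0 0)
                (fun k => stack4 (vt k) (pD k) (v k) (p k))
              <-> simple_pressure_eq tau M A B g vt pD 0 /\
                  simple_scheme tau M A B f g vt pD v p),
          regular_pair (simple_E tau M A B) (simple_A tau M A B)
        & has_index (simple_E tau M A B) (simple_A tau M A B) 1].
Proof.
have uM := posdef_unit hM.
have [tau0 tau0_gt0 hK] := schur_unit_near0 A uM (posdef_schur_unit hM hB).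
exists tau0 => // tau tau_gt0 /(hK _ tau_gt0)[uK uS].
have idx1 : has_index (simple_E tau M A B) (simple_A tau M A B) 1.
  by apply: simple_index1; rewrite ?gt_eqF.
split=> // [f g vt pD v p|]; first exact: simple_dae.
exact: has_index_regular idx1.
Qed.
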